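(* Let $\Omega$ be a finite set of size $n\ge3$. The minimal domination completions of $\mathcal{U}_{n-1,\Omega}$ are exactly the hypergraphs $\mathcal{D}(G)$ where $G$ is a disjoint union of stars with vertex set $\Omega$; that is, the set of minimal elements of $(\mathrm{Dom}(n-1,\Omega),\leqslant)$ equals $\{\mathcal{D}(G): G \text{ is a disjoint union of stars with vertex set }\Omega\}$.
   Context: Graphs are finite, simple, undirected; $\mathcal{D}(G)$ is the family of inclusion-minimal dominating sets of $G$ (a dominating set is $D\subseteq V(G)$ such that every vertex outside $D$ has a neighbour in $D$). A star is a tree of order $\ge2$ isomorphic to some $K_{1,m}$; a disjoint union of stars is a graph each of whose connected components is a star. A hypergraph on $\Omega$ is a nonempty family of nonempty subsets of $\Omega$, none a proper subset of another; it has ground set $\Omega$ if the union of its members is $\Omega$. A domination hypergraph is one of the form $\mathcal{D}(G)$. $\mathcal{U}_{r,\Omega}=\{A\subseteq\Omega:|A|=r\}$. $\mathcal{H}_1\leqslant\mathcal{H}_2$ means: for every $A_1\in\mathcal{H}_1$ there is $A_2\in\mathcal{H}_2$ with $A_2\subseteq A_1$. $\mathrm{Dom}(r,\Omega)$ is the set of domination hypergraphs with ground set $\Omega$ with $\mathcal{U}_{r,\Omega}\leqslant\mathcal{H}$. *)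

(* Defs.v *)
From mathcomp Require Import all_boot.

Set Implicit Arguments.
Unset Strict Implicit.
Unset Printing Implicit Defensive.

(* A finite simple graph whose vertex set is a subset of the finite type T. *)
Record sgraph (T : finType) := SGraph {
  vert : {set T};
  adj : rel T;
  adj_sym : symmetric adj;
  adj_irr : irreflexive adj;
  adj_vert : forall x y, adj x y -> x \in vert }.

Section Graphs.
Variable T : finType.
Implicit Types (G : sgraph T) (D S : {set T}).

Definition dominating G D : bool :=
  (D \subset vert G) &&
  [forall x in vert G :\: D, exists y in D, adj G x y].

Definition min_dom_sets G : {set {set T}} := [set D | minset (dominating G) D].

Definition induced_adj G S : rel T :=
  [rel x y | [&& x \in S, y \in S & adj G x y]].

Lemma induced_sym G S : symmetric (induced_adj G S).
Proof. by move=> x y; rewrite /induced_adj /= adj_sym andbCA. Qed.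

Lemma induced_irr G S : irreflexive (induced_adj G S).
Proof. by move=> x; rewrite /induced_adj /= adj_irr !andbF. Qed.

Lemma induced_vert G S x y : induced_adj G S x y -> x \in vert G :&: S.
Proof. by case/and3P=> xS _ /adj_vert xG; rewrite inE xG. Qed.

Definition induced G S : sgraph T :=
  SGraph (@induced_sym G S) (@induced_irr G S) (@induced_vert G S).

Definition component G (x : T) : {set T} := [set y | connect (adj G) x y].

End Graphs.

(* K_{1,m} on option 'I_m: the centre is None and the leaves are the Some i. *)
Definition star_adj (m : nat) : rel (option 'I_m) :=
  [rel x y | isSome x != isSome y].

Lemma star_sym m : symmetric (@star_adj m).
Proof. by move=> x y; rewrite /star_adj /= eq_sym. Qed.

Lemma star_irr m : irreflexive (@star_adj m).
Proof. by move=> x; rewrite /star_adj /= eqxx. Qed.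

Lemma star_vert m x y : @star_adj m x y -> x \in [set: option 'I_m].
Proof. by rewrite inE. Qed.

Definition star_graph (m : nat) : sgraph (option 'I_m) :=
  SGraph (@star_sym m) (@star_irr m) (@star_vert m).

Definition isomorphic (T U : finType) (G : sgraph T) (H : sgraph U) : Prop :=
  exists f : T -> U,
    [/\ {in vert G &, injective f}, f @: vert G = vert H
      & {in vert G &, forall x y, adj H (f x) (f y) = adj G x y}].

(* m >= 1 expresses that a star has order at least 2. *)
Definition is_star (T : finType) (G : sgraph T) : Prop :=
  exists2 m : nat, 1 <= m & isomorphic G (star_graph m).

Definition disjoint_union_of_stars (T : finType) (G : sgraph T) : Prop :=
  forall x, x \in vert G -> is_star (induced G (component G x)).

Section Hypergraphs.
Variable T : finType.
Implicit Types (H : {set {set T}}) (Omega : {set T}).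

Definition is_hypergraph H : Prop :=
  [/\ H != set0, set0 \notin H
    & forall A B, A \in H -> B \in H -> ~~ (A \proper B)].

Definition domination_hypergraph H : Prop :=
  is_hypergraph H /\ exists G : sgraph T, H = min_dom_sets G.

Definition uniform_hypergraph (r : nat) Omega : {set {set T}} :=
  [set A : {set T} | (A \subset Omega) && (#|A| == r)].

Definition hyp_le H1 H2 : Prop :=
  forall A1, A1 \in H1 -> exists2 A2, A2 \in H2 & A2 \subset A1.

(* cover H is the union of the members of H. *)
Definition Dom (r : nat) Omega H : Prop :=
  [/\ domination_hypergraph H, cover H = Omega
    & hyp_le (uniform_hypergraph r Omega) H].

(* hyp_le is antisymmetric on hypergraphs (antichains), so equality in the
   conclusion is the usual minimality in a partially ordered set. *)
Definition minimal_in (P : {set {set T}} -> Prop) H : Prop :=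
  P H /\ forall H', P H' -> hyp_le H' H -> H' = H.

End Hypergraphs.

(* Main.v *)
Require Import Defs.
From mathcomp Require Import all_boot.

(** A graph is a disjoint union of stars iff it has no isolated vertex and each
    of its edges has an endpoint of degree one.  The members of Dom (n - 1) Omega
    are the [min_dom_sets G] with G a graph on Omega without isolated vertices,
    since Omega minus x dominates G iff x has a neighbour.  Deleting edges
    without isolating a vertex leads to a spanning star forest and goes down
    for [hyp_le], so minimal completions come from star forests.  Conversely, let G
    be a star forest with [hyp_le (min_dom_sets G') (min_dom_sets G)].  If xy is an
    edge of G with x of degree one, the complement of {x, y} does not dominate G,
    hence not G' either, and as G' has no isolated vertex xy is an edge of G'.
    So G is a subgraph of G', which gives the reverse comparison. *)

Set Implicit Arguments.
Unset Strict Implicit.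
Unset Printing Implicit Defensive.

Section Domination.
Variable T : finType.
Implicit Types (G : sgraph T) (D A B : {set T}).

(** * Dominating sets and the comparison [hyp_le] between families of minimal ones *)

Definition no_isolated G := forall x, x \in vert G -> exists y, adj G x y.

Definition pendant G x y := adj G x y /\ forall z, adj G x z -> z = y.

Definition pendant_edges G := forall x y, adj G x y -> pendant G x y \/ pendant G y x.

Lemma adj_vertr G x y : adj G x y -> y \in vert G.
Proof. by rewrite adj_sym => /adj_vert. Qed.

Lemma dominatingP G D :
  reflect (D \subset vert G /\
           forall x, x \in vert G -> x \notin D -> exists2 y, y \in D & adj G x y)
          (dominating G D).
Proof.
apply: (iffP andP) => -[DG domD]; split=> //.
  move=> x xG xD; move/forall_inP: domD => /(_ x); rewrite !inE xD xG.
  by move=> /(_ isT) /exists_inP.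
by apply/forall_inP=> x /setDP[xG xD]; apply/exists_inP; apply: domD.
Qed.

Lemma dominating_sup G A B :
  dominating G A -> A \subset B -> B \subset vert G -> dominating G B.
Proof.
move=> /dominatingP[_ domA] AB BG; apply/dominatingP; split=> // x xG xB.
have [|y yA xy] := domA x xG; first by apply: contra xB; apply: (subsetP AB).
by exists y => //; apply: (subsetP AB).
Qed.

Lemma dominating_vert G : dominating G (vert G).
Proof. by apply/dominatingP; split=> // x ->. Qed.

Lemma min_dom_dominating G A : A \in min_dom_sets G -> dominating G A.
Proof. by rewrite inE => /minsetp. Qed.

Lemma min_dom_exists G D :
  dominating G D -> exists2 A, A \in min_dom_sets G & A \subset D.
Proof.
by move=> domD; have [A minA AD] := minset_exists domD; exists A; rewrite ?inE.
Qed.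

Lemma min_dom_antichain G A B :
  A \in min_dom_sets G -> B \in min_dom_sets G -> A \subset B -> A = B.
Proof. by move=> /min_dom_dominating domA; rewrite inE => /minsetinf; apply. Qed.

(** Going from [A] to [G2] and back gives members [C] and [B] with [C] inside [B] inside [A];
    minimality of [A] in [G1] collapses the chain. *)
Lemma hyp_le_min_dom_subset G1 G2 A :
  hyp_le (min_dom_sets G1) (min_dom_sets G2) ->
  hyp_le (min_dom_sets G2) (min_dom_sets G1) ->
  A \in min_dom_sets G1 -> A \in min_dom_sets G2.
Proof.
move=> le12 le21 A1; have [B B2 BA] := le12 A A1.
have [C C1 CB] := le21 B B2.
have CA : C = A := min_dom_antichain C1 A1 (subset_trans CB BA).
suff -> : A = B by [].
by apply/eqP; rewrite eqEsubset BA -{1}CA CB.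
Qed.

Lemma hyp_le_min_dom_anti G1 G2 :
  hyp_le (min_dom_sets G1) (min_dom_sets G2) ->
  hyp_le (min_dom_sets G2) (min_dom_sets G1) ->
  min_dom_sets G1 = min_dom_sets G2.
Proof. by move=> le12 le21; apply/setP=> A; apply/idP/idP; apply: hyp_le_min_dom_subset. Qed.

(** Adding edges keeps every dominating set dominating. *)
Lemma hyp_le_min_dom_subgraph G1 G2 :
  vert G1 = vert G2 -> subrel (adj G1) (adj G2) ->
  hyp_le (min_dom_sets G1) (min_dom_sets G2).
Proof.
move=> eqV sub12 A /min_dom_dominating/dominatingP[AG domA].
apply: min_dom_exists; apply/dominatingP; rewrite -eqV; split=> // x xG xA.
by have [y yA xy] := domA x xG xA; exists y => //; apply: sub12.
Qed.

Lemma hyp_le_dominating G1 G2 D :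
  hyp_le (min_dom_sets G1) (min_dom_sets G2) -> D \subset vert G2 ->
  dominating G1 D -> dominating G2 D.
Proof.
move=> le12 DG /min_dom_exists[A A1 AD]; have [B B2 BA] := le12 A A1.
exact: dominating_sup (min_dom_dominating B2) (subset_trans BA AD) DG.
Qed.

(* The non-neighbours of x form a dominating set, all of whose dominating
   subsets contain x. *)
Lemma cover_min_dom G : cover (min_dom_sets G) = vert G.
Proof.
apply/eqP; rewrite eqEsubset; apply/andP; split.
  by apply/bigcupsP=> A /min_dom_dominating/dominatingP[].
apply/subsetP=> x xG; pose S := [set y in vert G | ~~ adj G x y].
have domS : dominating G S.
  apply/dominatingP; split=> [|y yG]; first by apply/subsetP=> y; rewrite inE => /andP[].
  rewrite inE yG negbK adj_sym => yx; exists x => //.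
  by rewrite inE xG adj_irr.
have [A minA AS] := min_dom_exists domS.
apply/bigcupP; exists A => //; apply: contraT => xA.
have /dominatingP[_ /(_ x xG xA)[y yA xy]] := min_dom_dominating minA.
by have := subsetP AS y yA; rewrite inE xy andbF.
Qed.

Lemma Dom_min_dom (Omega : {set T}) G : 0 < #|Omega| ->
  Dom (#|Omega| - 1) Omega (min_dom_sets G) <-> vert G = Omega /\ no_isolated G.
Proof.
move=> Omega_gt0; split.
  case=> _; rewrite cover_min_dom => eqV leU; split=> // x; rewrite eqV => xO.
  have [|A minA AO] := leU (Omega :\ x).
    by rewrite inE subD1set /= (cardsD1 x Omega) xO addKn.
  have /dominatingP[_ /(_ x)] := min_dom_dominating minA.
  rewrite eqV => /(_ xO)[|y _ xy]; last by exists y.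
  by apply/negP=> /(subsetP AO); rewrite !inE eqxx.
move=> [eqV isoG]; split; first split.
- split.
  + by have [A minA _] := min_dom_exists (dominating_vert G); apply/set0Pn; exists A.
  + apply/negP=> /min_dom_dominating/dominatingP[_ dom0].
    (* The empty set fails to dominate any chosen vertex [x]. *)
    have [x xO] := card_gt0P Omega_gt0.
    by have [||y] := dom0 x; rewrite ?eqV ?inE.
  + move=> A B minA minB; apply/negP=> AB.
    have eqAB := min_dom_antichain minA minB (proper_sub AB).
    by move: AB; rewrite eqAB properxx.
- by exists G.
- by rewrite cover_min_dom.
move=> A; rewrite inE => /andP[AO /eqP cardA]; apply: min_dom_exists.
apply/dominatingP; rewrite eqV; split=> // x xO xA.
(* By its size, [A] misses only [x], so any neighbour of [x] lies in [A]. *)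
have eqA : A = Omega :\ x.
  apply/eqP; rewrite eqEcard subsetD1 AO xA cardA.
  by rewrite (cardsD1 x Omega) xO addKn leqnn.
have [|y xy] := isoG x; first by rewrite eqV.
exists y => //; rewrite eqA !inE -eqV (adj_vertr xy) andbT.
by apply: contraTneq xy => ->; rewrite adj_irr.
Qed.

Lemma hyp_le_pendant_edge G G' x y :
  vert G' = vert G -> no_isolated G' ->
  hyp_le (min_dom_sets G') (min_dom_sets G) -> pendant G x y -> adj G' x y.
Proof.
move=> eqV isoG' le [xy uniq_y]; pose D := vert G :\: [set x; y].
apply: contraT => nxy.
(* [D] cannot dominate [G]: the only neighbour [y] of [x] is outside [D]. *)
suff : dominating G D.
  move=> /dominatingP[_ /(_ x (adj_vert xy))].
  rewrite !inE eqxx => /(_ isT)[z zD /uniq_y eqz].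
  by move: zD; rewrite eqz !inE eqxx orbT.
apply: (hyp_le_dominating le); first exact: subsetDl.
apply/dominatingP; rewrite eqV; split=> [|z zG zD]; first exact: subsetDl.
have {zD} zxy : z \in [set x; y] by move: zD; rewrite in_setD zG andbT negbK.
have [|w zw] := isoG' z; first by rewrite eqV.
(* Here [z] is [x] or [y]; were [w] one of them too, [zw] would be a loop or the excluded edge
   [xy]. *)
exists w => //; rewrite in_setD -eqV (adj_vertr zw) andbT.
apply: contra nxy; move: zw; rewrite !inE.
case/set2P: zxy => ->.
  by move=> /[swap] /orP[] /eqP-> //; rewrite adj_irr.
by move=> /[swap] /orP[] /eqP->; [rewrite adj_sym | rewrite adj_irr].
Qed.

(** * Deleting edges down to a spanning star forest *)

Section DeleteEdge.
Variables (G : sgraph T) (a b : T).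

(** Comparing unordered pairs removes both orientations of the edge at once. *)
Definition del_edge_adj : rel T :=
  [rel x y | adj G x y && ([set x; y] != [set a; b])].

Lemma del_edge_sym : symmetric del_edge_adj.
Proof. by move=> x y; rewrite /del_edge_adj /= adj_sym setUC. Qed.

Lemma del_edge_irr : irreflexive del_edge_adj.
Proof. by move=> x; rewrite /del_edge_adj /= adj_irr. Qed.

Lemma del_edge_vert x y : del_edge_adj x y -> x \in vert G.
Proof. by case/andP=> /adj_vert. Qed.

Definition del_edge : sgraph T := SGraph del_edge_sym del_edge_irr del_edge_vert.

End DeleteEdge.

Lemma eq_set2_edge (x y a b : T) :
  [set x; y] = [set a; b] -> x = a /\ y = b \/ x = b /\ y = a.
Proof.
move=> E; have [] : (a \in [set x; y]) /\ (b \in [set x; y]) by rewrite E !inE !eqxx orbT.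
have [] : (x \in [set a; b]) /\ (y \in [set a; b]) by rewrite -E !inE !eqxx orbT.
by move=> /set2P[] -> /set2P[] -> /set2P[] ? /set2P[] ?; subst; auto.
Qed.

Lemma pendantPn G x y : adj G x y ->
  pendant G x y \/ exists2 z, adj G x z & z != y.
Proof.
move=> xy; have [/existsP[z /andP[xz zy]]|/existsPn no_z] :=
  boolP [exists z, adj G x z && (z != y)]; first by right; exists z.
left; split=> // z xz; apply/eqP; move: (no_z z); rewrite xz /=.
by rewrite negbK.
Qed.

Lemma no_isolated_del_edge G a b :
  no_isolated G -> (exists2 z, adj G a z & z != b) ->
  (exists2 z, adj G b z & z != a) -> no_isolated (del_edge G a b).
Proof.
move=> isoG [u au ub] [v bv va] x xG.
have [y xy] := isoG x xG.
have [E|ne] := eqVneq [set x; y] [set a; b]; last by exists y; apply/andP.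
have [[-> _]|[-> _]] := eq_set2_edge E.
  exists u; apply/andP; split=> //; apply/eqP=> /eq_set2_edge[[_ eu]|[eab eu]].
    by rewrite eu eqxx in ub.
  by rewrite eu adj_irr in au.
exists v; apply/andP; split=> //; apply/eqP=> /eq_set2_edge[[eba ev]|[_ ev]].
  by rewrite ev adj_irr in bv.
by rewrite ev eqxx in va.
Qed.

(** Induction on the number of ordered adjacent pairs. An edge whose two ends both have another
    neighbour can be deleted without isolating a vertex; once no such edge is left, every edge is
    pendant. *)
Lemma spanning_pendant_edges G : no_isolated G ->
  exists G', [/\ vert G' = vert G, subrel (adj G') (adj G),
                 no_isolated G' & pendant_edges G'].
Proof.
have [k] := ubnP #|[set e : T * T | adj G e.1 e.2]|.
elim: k G => // k IHk G leGk isoG.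
pose bad e := [&& adj G e.1 e.2, [exists z, adj G e.1 z && (z != e.2)]
                & [exists z, adj G e.2 z && (z != e.1)]].
have [/existsP[[a b] /= /and3P[/= ab /exists_inP aP /exists_inP bP]]|/existsPn no_bad] :=
  boolP [exists e, bad e].
  have [||G' [eqV sub isoG' pG']] := IHk (del_edge G a b).
  - rewrite ltnS in leGk; apply: leq_trans leGk; apply: proper_card.
    apply/properP; split; first by apply/subsetP=> e; rewrite !inE => /andP[].
    by exists (a, b); rewrite inE //= /del_edge_adj /= eqxx andbF.
  - exact: no_isolated_del_edge.
  by exists G'; split=> // x y /sub /andP[].
exists G; split=> // x y xy.
have [|[z xz zy]] := pendantPn xy; first by left.
have [|[w yw wx]] := pendantPn (etrans (adj_sym G y x) xy); first by right.
case/negP: (no_bad (x, y)); apply/and3P; split=> //; apply/existsP.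
  by exists z; apply/andP.
by exists w; apply/andP.
Qed.

(** * Star forests characterised by their pendant edges *)

Lemma star_adj_cases m (u v : option 'I_m) :
  star_adj u v -> (u = None /\ v) \/ (v = None /\ u).
Proof. by case: u v => [?|] [?|] //; auto. Qed.

Lemma component_adj G x y z : y \in component G x -> adj G y z -> z \in component G x.
Proof. by rewrite !inE => xy yz; apply: connect_trans xy (connect1 yz). Qed.

Lemma component_refl G x : x \in component G x.
Proof. by rewrite inE connect0. Qed.

Lemma stars_no_isolated G : disjoint_union_of_stars G -> no_isolated G.
Proof.
move=> starG x xG; have [m m_gt0 [f [_ imf adjf]]] := starG x xG.
have xC : x \in vert (induced G (component G x)) by rewrite inE xG component_refl.
(* A vertex of the star on the side opposite to [f x]; when [f x] is the centre, a leaf exists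
   because [m] is positive. *)
pose u : option 'I_m := if f x is Some _ then None else Some (Ordinal m_gt0).
have : u \in f @: vert (induced G (component G x)) by rewrite imf inE.
case/imsetP=> y yC eq_u; exists y.
have : adj (star_graph m) (f x) (f y) by rewrite -eq_u /u; case: (f x).
by rewrite adjf // => /and3P[].
Qed.

Lemma stars_pendant_edges G : disjoint_union_of_stars G -> pendant_edges G.
Proof.
move=> starG x y xy; have xG := adj_vert xy.
have [m _ [f [injf _ adjf]]] := starG x xG.
set K := induced _ _ in injf adjf.
have yx : adj G y x by rewrite adj_sym.
have xC : x \in component G x := component_refl G x.
have yC := component_adj xC xy.
have inK z : z \in vert G -> z \in component G x -> z \in vert K.
  by move=> zG zC; rewrite inE zG.
(* When [f] sends [u] to the centre, its neighbour [v] goes to a leaf, so any neighbour [w] of [v]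
   goes to the centre and equals [u] by injectivity. *)
have sameN u v w : u \in component G x -> f u = None -> adj G u v -> adj G v w -> w = u.
  move=> uC fu uv vw; have vC := component_adj uC uv; have wC := component_adj vC vw.
  have [uK vK wK] : [/\ u \in vert K, v \in vert K & w \in vert K].
    by split; apply: inK => //; [apply: adj_vert uv|apply: adj_vert vw|apply: adj_vertr vw].
  apply: injf => //; rewrite fu.
  have : adj (star_graph m) (f u) (f v) by rewrite adjf //; apply/and3P.
  have : adj (star_graph m) (f v) (f w) by rewrite adjf //; apply/and3P.
  by rewrite fu /=; case: (f v) => // ?; case: (f w).
have : adj (star_graph m) (f x) (f y).
  by rewrite adjf ?inK //; [apply/and3P|apply: adj_vertr xy].
case/star_adj_cases=> -[fN _].
  by right; split=> // z; apply: sameN.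
by left; split=> // z; apply: sameN.
Qed.

(** If [x] has a single neighbour, that neighbour serves as centre; otherwise [x] has two neighbours
    and is itself the centre. In a single edge either end would do. *)
Lemma pendant_edges_center G x : no_isolated G -> pendant_edges G -> x \in vert G ->
  exists c, [/\ x = c \/ adj G c x, exists y, adj G c y
              & forall z, adj G c z -> pendant G z c].
Proof.
move=> isoG pG xG; have [y xy] := isoG x xG.
have yx : adj G y x by rewrite adj_sym.
have [px|[w xw wy]] := pendantPn xy.
  exists y; split; [by right | by exists x |] => z yz.
  by have [[_ /(_ x yx) <-]|] := pG y z yz.
exists x; split; [by left | by exists y |] => z xz.
have [[_ uniq_z]|//] := pG x z xz.
by rewrite (uniq_z w xw) (uniq_z y xy) eqxx in wy.
Qed.

(** The closed neighbourhood of [c] is closed under adjacency, since its leaves lead only back to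
    [c]. *)
Lemma component_center G c x :
  (forall z, adj G c z -> pendant G z c) -> x = c \/ adj G c x ->
  component G x = c |: [set z | adj G c z].
Proof.
move=> pc xc; have adjC : connect_sym (adj G).
  by apply: sym_connect_sym; apply: adj_sym.
have cx : connect (adj G) c x by case: xc => [->|/connect1].
have closedS : closed (adj G) (c |: [set z | adj G c z]).
  apply: intro_closed => // u v uv; rewrite !inE.
  case/orP=> [/eqP eu|cu]; first by rewrite -eu uv orbT.
  by have [_ /(_ v uv) ->] := pc u cu; rewrite eqxx.
apply/setP=> z; rewrite inE -(same_connect adjC cx); apply/idP/idP.
  by move/(closed_connect closedS) => <-; rewrite !inE eqxx.
by rewrite !inE => /orP[/eqP->|/connect1].
Qed.

Lemma pendant_edges_stars G :
  no_isolated G -> pendant_edges G -> disjoint_union_of_stars G.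
Proof.
move=> isoG pG x xG.
have [c [xc [y cy] pc]] := pendant_edges_center isoG pG xG.
have eqC := component_center pc xc.
pose N := [set z | adj G c z].
have yN : y \in N by rewrite inE.
exists #|N|; first by apply/card_gt0P; exists y.
have vertK : vert (induced G (component G x)) = c |: N.
  rewrite /= eqC; apply/setIidPr/subsetP=> z; rewrite !inE.
  by case/orP=> [/eqP->|/adj_vertr //]; apply: adj_vert cy.
have cN : c \notin N by rewrite inE adj_irr.
have neN z : z \in N -> (z == c) = false.
  by move=> zN; apply/negbTE; apply: contraNneq cN => <-.
(* The centre goes to [None] and the leaves are numbered by their rank in [N]; [yN] supplies the
   inhabitant that [enum_rank_in] requires. *)
pose f z := if z == c then None else Some (enum_rank_in yN z).
exists f; rewrite vertK; split.
- move=> u v /setU1P[->|uN] /setU1P[->|vN]; rewrite /f ?eqxx ?neN //.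
  by case=> /(enum_rank_in_inj uN vN).
- apply/setP=> -[i|]; rewrite [RHS]inE; apply/imsetP.
    exists (enum_val i); first by rewrite in_setU1 enum_valP orbT.
    by rewrite /f (neN _ (enum_valP i)) enum_valK_in.
  by exists c; rewrite ?setU11 // /f eqxx.
move=> u v uS vS; rewrite /= /induced_adj /= eqC uS vS /=.
case/setU1P: uS => [->|uN]; case/setU1P: vS => [->|vN]; rewrite /f ?eqxx ?neN //=.
- by rewrite adj_irr.
- by move: vN; rewrite inE => ->.
- by move: uN; rewrite inE adj_sym => ->.
(* An edge between leaves [u] and [v] would force [v] to be [c], which is not in [N]. *)
apply/esym/negbTE; apply/negP=> uv; move: (uN); rewrite inE => /pc[_ /(_ v uv) ev].
by move: cN; rewrite -ev vN.
Qed.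

End Domination.

Theorem theorem4p8 (T : finType) (Omega : {set T}) (n : nat)
    (card_Omega : #|Omega| = n) (n_ge3 : 3 <= n) :
  forall H : {set {set T}},
    minimal_in (Dom (n - 1) Omega) H <->
    (exists G : sgraph T,
       [/\ vert G = Omega, disjoint_union_of_stars G & H = min_dom_sets G]).
Proof.
rewrite -card_Omega in n_ge3 *; have Omega_gt0 : 0 < #|Omega| by apply: leq_trans n_ge3.
move=> H; split.
  case=> DomH minH; have [[_ [G eqH]] _ _] := DomH; subst H.
  have [eqV isoG] := (Dom_min_dom G Omega_gt0).1 DomH.
  have [G' [eqV' sub isoG' pG']] := spanning_pendant_edges isoG.
  exists G'; split; [by rewrite eqV' | exact: pendant_edges_stars |].
  (* The spanning star forest [G'] lies below [G], so minimality makes the two families equal. *)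
  apply/esym/minH; last exact: hyp_le_min_dom_subgraph.
  by apply/(Dom_min_dom G' Omega_gt0); rewrite eqV'.
case=> G [eqV starG ->].
have pG := stars_pendant_edges starG.
split; first by apply/(Dom_min_dom G Omega_gt0); split=> //; apply: stars_no_isolated.
move=> H' DomH' le; have [[_ [G' eqH']] _ _] := DomH'; subst H'.
have [eqV' isoG'] := (Dom_min_dom G' Omega_gt0).1 DomH'.
have eqVV : vert G' = vert G by rewrite eqV'.
apply: hyp_le_min_dom_anti => //; apply: hyp_le_min_dom_subgraph => // x y xy.
(* Whichever end of [xy] is the leaf, the edge survives in [G']. *)
have [|] := pG x y xy; first exact: hyp_le_pendant_edge.
by move=> pyx; rewrite adj_sym; apply: hyp_le_pendant_edge pyx.
Qed.
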